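(* Let $\mathfrak R$ be a (complete, separated, right linear) topological ring with a countable base of open neighborhoods of zero. Then the following are equivalent: (1) $\mathfrak R$ is topologically semiperfect; (2) each discrete simple right $\mathfrak R$-module has a projective cover in the category of right $\mathfrak R$-modules; (3) each finitely generated discrete right $\mathfrak R$-module has a projective cover in the category of right $\mathfrak R$-modules.
   Context: All rings are associative and unital. A topological ring $\mathfrak R$ is complete, separated and right linear if open right ideals $\mathfrak I$ form a base of neighborhoods of zero and $\mathfrak R\to\varprojlim_{\mathfrak I}\mathfrak R/\mathfrak I$ is bijective. A family $(r_x)_{x\in X}$ in $\mathfrak R$ is zero-convergent if every open right ideal contains $r_x$ for all but finitely many $x$; infinite sums of zero-convergent families are limits of finite partial sums. A nonzero ring is local if its noninvertible elements form an additive subgroup. $\mathfrak R$ is topologically semiperfect if there exist a set $Z$ and a zero-convergent family $(e_z)_{z\in Z}$ of pairwise orthogonal idempotents in $\mathfrak R$ with $\sum_{z\in Z}e_z=1$ such that every ring $e_z\mathfrak R e_z$ is local. A right $\mathfrak R$-module is discrete if the annihilator of each of its elements is an open right ideal in $\mathfrak R$. The category of right $\mathfrak R$-modules means that of all abstract right $\mathfrak R$-modules. A projective cover of a module $M$ is a surjective homomorphism $P\to M$ with $P$ projective and with superfluous kernel. *)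

(* Defs.v *)
From HB Require Import structures.
From mathcomp Require Import all_boot all_algebra finmap.
From mathcomp Require Import all_classical topology.
From mathcomp Require Import pseudometric_normed_Zmodule tvs.
From mathcomp Require summability.

Set Implicit Arguments.
Unset Strict Implicit.
Unset Printing Implicit Defensive.

Import GRing.Theory.
Local Open Scope classical_set_scope.
Local Open Scope ring_scope.

HB.mixin Record TopologicalZmodule_isTopologicalPzRing R
    & TopologicalZmodule R & GRing.PzRing R := {
  mul_continuous : continuous (fun x : R * R => x.1 * x.2)
}.

(* The ring may be zero and need not be commutative. *)
#[short(type="topologicalPzRingType")]
HB.structure Definition TopologicalPzRing :=
  {R of TopologicalZmodule R & GRing.PzRing R
      & TopologicalZmodule_isTopologicalPzRing R}.

Section Rings.
Variable A : pzRingType.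

Definition invertible (x : A) := exists y, x * y = 1 /\ y * x = 1.

Definition local_ring := (1 : A) <> 0 /\
  [/\ ~ invertible 0,
      (forall x y, ~ invertible x -> ~ invertible y -> ~ invertible (x + y))
    & (forall x, ~ invertible x -> ~ invertible (- x))].

End Rings.

(* The ring e A e, with unit e; since e is idempotent, its elements are the
   fixed points of x |-> e x e. *)
Section Corner.
Variables (A : pzRingType) (e : A).

Record corner (ee : e * e = e) : Type :=
  Corner { corner_val : A; _ : e * corner_val * e == corner_val }.

Variable ee : e * e = e.
Local Notation C := (corner ee).

HB.instance Definition _ := [isSub for @corner_val ee].
HB.instance Definition _ := [Choice of C by <:].

Lemma cornerE (x : C) : e * val x * e = val x.
Proof. by case: x => x /= /eqP. Qed.

Lemma corner_mull (x : C) : e * val x = val x.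
Proof. by rewrite -cornerE !mulrA ee. Qed.

Lemma corner_mulr (x : C) : val x * e = val x.
Proof. by rewrite -cornerE -!mulrA ee. Qed.

Fact corner0_subproof : e * 0 * e == 0.
Proof. by rewrite mulr0 mul0r. Qed.

Fact corner1_subproof : e * e * e == e.
Proof. by rewrite !ee. Qed.

Fact cornerD_subproof (x y : C) : e * (val x + val y) * e == val x + val y.
Proof. by rewrite mulrDr mulrDl !cornerE. Qed.

Fact cornerN_subproof (x : C) : e * (- val x) * e == - val x.
Proof. by rewrite mulrN mulNr cornerE. Qed.

Fact cornerM_subproof (x y : C) : e * (val x * val y) * e == val x * val y.
Proof. by rewrite mulrA corner_mull -mulrA corner_mulr. Qed.

Definition corner0 : C := Corner ee corner0_subproof.
Definition corner1 : C := Corner ee corner1_subproof.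
Definition corner_add (x y : C) : C := Corner ee (cornerD_subproof x y).
Definition corner_opp (x : C) : C := Corner ee (cornerN_subproof x).
Definition corner_mul (x y : C) : C := Corner ee (cornerM_subproof x y).

Fact corner_addA : associative corner_add.
Proof. by move=> x y z; apply: val_inj; rewrite /= addrA. Qed.
Fact corner_addC : commutative corner_add.
Proof. by move=> x y; apply: val_inj; rewrite /= addrC. Qed.
Fact corner_add0 : left_id corner0 corner_add.
Proof. by move=> x; apply: val_inj; rewrite /= add0r. Qed.
Fact corner_addN : left_inverse corner0 corner_opp corner_add.
Proof. by move=> x; apply: val_inj; rewrite /= addNr. Qed.

HB.instance Definition _ := Algebra.isZmodule.Build C
  corner_addA corner_addC corner_add0 corner_addN.

Fact corner_mulA : associative corner_mul.
Proof. by move=> x y z; apply: val_inj; rewrite /= mulrA. Qed.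
Fact corner_mul1 : left_id corner1 corner_mul.
Proof. by move=> x; apply: val_inj; exact: corner_mull. Qed.
Fact corner_1mul : right_id corner1 corner_mul.
Proof. by move=> x; apply: val_inj; exact: corner_mulr. Qed.
Fact corner_mulDl : left_distributive corner_mul +%R.
Proof. by move=> x y z; apply: val_inj; rewrite /= mulrDl. Qed.
Fact corner_mulDr : right_distributive corner_mul +%R.
Proof. by move=> x y z; apply: val_inj; rewrite /= mulrDr. Qed.

HB.instance Definition _ := GRing.Zmodule_isPzRing.Build C
  corner_mulA corner_mul1 corner_1mul corner_mulDl corner_mulDr.

End Corner.

Section Modules.
Variable S : pzRingType.

Definition submodule (M : lmodType S) (N : set M) :=
  [/\ N 0, (forall x y, N x -> N y -> N (x + y))
         & (forall a x, N x -> N (a *: x))].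

Definition simple_module (M : lmodType S) :=
  (exists x : M, x <> 0) /\
  forall N : set M, submodule N -> N = [set 0] \/ N = setT.

Definition finitely_generated (M : lmodType S) :=
  exists (n : nat) (g : 'I_n -> M),
    forall x, exists a : 'I_n -> S, x = \sum_(i < n) a i *: g i.

Definition surjective (U V : Type) (f : U -> V) := range f = setT.

Definition projective_module (P : lmodType S) :=
  forall (M N : lmodType S) (g : {linear M -> N}) (f : {linear P -> N}),
    surjective g -> exists h : {linear P -> M}, forall x, g (h x) = f x.

Definition superfluous (M : lmodType S) (K : set M) :=
  forall L : set M, submodule L ->
    [set x + y | x in K & y in L] = setT -> L = setT.

Definition has_projective_cover (M : lmodType S) :=
  exists (P : lmodType S) (p : {linear P -> M}),
    [/\ projective_module P, surjective p & superfluous (p @^-1` [set 0])].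

End Modules.

(* Right R-modules are left modules over the opposite ring R^c: the scalar
   product r *: m stands for m r. *)
Notation rmodType R := (lmodType R^c).

Section LinearlyTopologicalRings.
Variable R : topologicalPzRingType.

(* Closure under opposites follows from - x = x * (- 1). *)
Definition right_ideal (I : set R) :=
  [/\ I 0, (forall x y, I x -> I y -> I (x + y))
         & (forall x r, I x -> I (x * r))].

Record open_right_ideal := OpenRightIdeal {
  ideal_set :> set R;
  ideal_open : open ideal_set;
  ideal_right : right_ideal ideal_set
}.

Definition right_linear :=
  forall U : set R, nbhs 0 U -> exists I : open_right_ideal, I `<=` U.

Definition coset (I : open_right_ideal) (r : R) : set R :=
  [set r + x | x in I].

(* The projective limit of the R / I, whose elements are cosets; the image in
   R / I of a coset of J `<=` I is the coset of I which contains it. *)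
Definition limit_of_quotients : set (open_right_ideal -> set R) :=
  [set F | (forall I, range (coset I) (F I)) /\
           (forall I J : open_right_ideal, J `<=` I -> F J `<=` F I)].

Definition to_limit (r : R) : open_right_ideal -> set R :=
  fun I => coset I r.

Definition complete_separated_right_linear :=
  right_linear /\ set_bij [set: R] limit_of_quotients to_limit.

Definition countable_base_at0 :=
  exists B : set (set R), [/\ countable B, (forall U, B U -> open_nbhs 0 U)
    & (forall U, nbhs 0 U -> exists2 V, B V & V `<=` U)].

Definition zero_convergent (X : Type) (r : X -> R) :=
  forall I : open_right_ideal, finite_set [set x | ~ ideal_set I (r x)].

Definition sums_to (X : choiceType) (r : X -> R) (s : R) :=
  summability.partial_sum r @ summability.totally --> s.

Definition topologically_semiperfect :=
  exists (Z : choiceType) (e : Z -> R) (ee : forall z, e z * e z = e z),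
    [/\ zero_convergent e,
        (forall z w, z <> w -> e z * e w = 0),
        sums_to e 1
      & (forall z, local_ring (corner (ee z)))].

Definition annihilator (M : rmodType R) (m : M) : set R :=
  [set r | (r : R^c) *: m = 0].

Definition discrete_module (M : rmodType R) :=
  forall m : M, open (annihilator m) /\ right_ideal (annihilator m).

End LinearlyTopologicalRings.

(* Main.v *)
Require Import Defs.
From mathcomp Require Import all_boot all_algebra.
From HB Require Import structures.
From mathcomp Require Import finmap all_classical topology.
From mathcomp Require Import pseudometric_normed_Zmodule tvs.
From mathcomp Require summability.

(**
Right R-modules are treated as left modules over the opposite ring S, so that
idempotents act on the left and a right ideal of R is a left ideal of S.  A
module element m with e m = m for a local idempotent e is the image of e under
a homomorphism S e -> M, and S e is a projective module with a local
endomorphism ring.  The whole proof turns on finite families of such elements.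

Suppose that M is generated by finitely many elements m_j = e_j m_j with e_j
local, and that no m_j can be discarded (irredundant_subfamily).  Then the
obvious map from the direct sum of the S e_j onto M is a projective cover
(irredundant_projective_cover).  Indeed, a coordinate of an element of the
kernel never generates S e_j, since otherwise m_j would be redundant; because
e_j is local, that coordinate lies in the Jacobson radical (jacobson_of_local).
Nakayama's lemma then makes the kernel superfluous.

If R is topologically semiperfect with idempotents e_z, a generator g of a
discrete module is annihilated by 1 minus some finite partial sum of the e_z.
Hence g is a finite sum of elements e_z g, and every finitely generated
discrete module is of the kind above (semiperfect_covers).  Simple modules are
finitely generated, so covers of finitely generated discrete modules include
those of the simple ones.

Conversely, suppose that the discrete simple modules have projective covers.  A
cover of a simple module is S e for a local idempotent e
(simple_cover_idempotent).  Therefore, for every open left ideal I of S, the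
left ideals S e with e local generate S together with I: otherwise their sum
with I would lie in a maximal left ideal N, open because it contains I, and the
cover of the discrete simple module S / N would provide a local idempotent
outside N (local_idempotents_dense).  It follows that for an idempotent f and
an open left ideal J, the image of f in S / J generates a submodule with an
irredundant family of local generators.  Lifting the map S f -> S f / (S f meet
J) to the projective cover built from that family splits off of f finitely many
orthogonal local idempotents, with the rest of f in J
(idempotent_splitting).  Starting with f = 1 and running through a countable
base I_0, I_1, ... of open ideals, this leaves successive rests
1 = f_0, f_1, ... with f_(n+1) in I_n.  All idempotents split off after stage n
lie in the ideal of f_(n+1), hence in I_n; this makes the family
zero-convergent with sum 1 (covers_semiperfect).
*)

Set Implicit Arguments.
Unset Strict Implicit.
Unset Printing Implicit Defensive.

Import GRing.Theory.
Local Open Scope classical_set_scope.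
Local Open Scope ring_scope.

(** * Submodules *)

Section Submodules.
Variables (S : pzRingType) (M : lmodType S) (L : set M).
Hypothesis subL : submodule L.

Lemma submodule0 : L 0. Proof. by case: subL. Qed.

Lemma submoduleD x y : L x -> L y -> L (x + y).
Proof. by case: subL => _ H _; apply: H. Qed.

Lemma submoduleZ a x : L x -> L (a *: x).
Proof. by case: subL => _ _ H; apply: H. Qed.

Lemma submoduleN x : L x -> L (- x).
Proof. by rewrite -scaleN1r; exact: submoduleZ. Qed.

Lemma submoduleB x y : L x -> L y -> L (x - y).
Proof. by move=> Lx Ly; apply: submoduleD => //; exact: submoduleN. Qed.

Lemma submodule_sum (I : Type) (r : seq I) (P : pred I) (F : I -> M) :
  (forall i, P i -> L (F i)) -> L (\sum_(i <- r | P i) F i).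
Proof.
move=> LF; elim/big_ind: _ => //; [exact: submodule0 | exact: submoduleD].
Qed.

End Submodules.

(** * Local idempotents and the Jacobson radical *)

Section Local.
Variable S : pzRingType.

(** The corner ring e S e is local as soon as, of any two of its elements with
    sum e, one has a left inverse; the one-sided condition is what arises from
    cyclic modules, and c may be taken in S since e c e serves as well. *)
Definition local_idempotent (e : S) :=
  [/\ e * e = e, e <> 0
    & forall s, e * s * e = s -> exists c, c * s = e \/ c * (e - s) = e].

Definition jacobson (x : S) := forall s, exists t, t * (1 - s * x) = 1.

Lemma jacobsonMl a x : jacobson x -> jacobson (a * x).
Proof. by move=> radx s; have [t] := radx (s * a); exists t; rewrite mulrA. Qed.

Lemma jacobsonD x y : jacobson x -> jacobson y -> jacobson (x + y).
Proof.
move=> radx rady s; have [t tx] := radx s; have [u uy] := rady (t * s).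
by exists (u * t); rewrite [s * _]mulrDr opprD addrA -mulrA mulrBr tx mulrA.
Qed.

(** In a local corner a non-generator of S e is quasi-regular: e s x is not left
    invertible in e S e, so e - e s x is, and a left inverse c of it gives the
    left inverse 1 + s x c e of 1 - s x. *)
Lemma jacobson_of_local e x : local_idempotent e -> x * e = x ->
  (forall c, c * x <> e) -> jacobson x.
Proof.
move=> [ee _ le] xe nx s.
have esx : e * (e * s * x) * e = e * s * x by rewrite !mulrA ee -mulrA xe.
have [c [cE|cE]] := le _ esx.
  by case: (nx (c * (e * s))); rewrite -mulrA.
exists (1 + s * x * c * e).
rewrite mulrDl mul1r.
suff -> : s * x * c * e * (1 - s * x) = s * x by rewrite subrK.
by rewrite -mulrA mulrBr mulr1 [e * (s * x)]mulrA -mulrA cE -mulrA xe.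
Qed.

(** The corner at a c is isomorphic to the corner at e = c a by s |-> c s a, so
    an inverse d found in the latter yields a d c in the former. *)
Lemma local_transfer e a c : local_idempotent e ->
  a * e = a -> e * c = c -> c * a = e -> local_idempotent (a * c).
Proof.
move=> [ee e0 le] ae ec ca.
have EE : a * c * (a * c) = a * c by rewrite mulrA -[_ * a]mulrA ca ae.
have cE : c * (a * c) = c by rewrite mulrA ca.
have Ea : a * c * a = a by rewrite -mulrA ca.
split=> // [E0|s sE]; first by apply: e0; rewrite -ca -Ea E0 mul0r mulr0.
have cs : c * s * a * c = c * s.
  by rewrite -sE -!mulrA !(mulrA c a) ca ec.
have [|d dE] := le (c * s * a); first by rewrite !mulrA ec -mulrA ae.
exists (a * d * c); case: dE => dE; [left|right].
  by rewrite -2!mulrA -cs [d * _]mulrA dE ec.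
by rewrite -2!mulrA mulrBr cE -cs -{1}ec -mulrBl [d * _]mulrA dE ec.
Qed.

Lemma orthogonal_complement k (f : S) (E : 'I_k -> S) :
  f * f = f -> (forall j, E j * E j = E j) -> (forall j, f * E j * f = E j) ->
  (forall i j, i <> j -> E i * E j = 0) ->
  let g := f - \sum_j E j in
  [/\ g * g = g, f * g = g, g * f = g
    & forall i, E i * g = 0 /\ g * E i = 0].
Proof.
move=> ff EE fEf orthE g.
have fE j : f * E j = E j by rewrite -fEf !mulrA ff.
have Ef j : E j * f = E j by rewrite -fEf -!mulrA ff.
have Eg i : E i * g = 0.
  rewrite mulrBr Ef mulr_sumr (bigD1 i) //= EE big1 ?addr0 ?subrr // => j ji.
  by apply: orthE => ij; rewrite ij eqxx in ji.
have gE i : g * E i = 0.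
  rewrite mulrBl fE mulr_suml (bigD1 i) //= EE big1 ?addr0 ?subrr // => j ji.
  by apply: orthE => ij; rewrite ij eqxx in ji.
have fg : f * g = g.
  by rewrite mulrBr ff mulr_sumr; under eq_bigr do rewrite fE.
have gf : g * f = g.
  by rewrite mulrBl ff mulr_suml; under eq_bigr do rewrite Ef.
split=> //; rewrite {1}/g mulrBl fg mulr_suml big1 ?subr0 // => j _.
Qed.

(** Since 1 - r is left invertible for r in the radical, the generators are
    eliminated one at a time, each through L and the remaining ones. *)
Lemma nakayama (M : lmodType S) (L : set M) k (w : 'I_k -> M) :
  submodule L ->
  (forall i, exists r : 'I_k -> S,
     (forall j, jacobson (r j)) /\ L (w i - \sum_j r j *: w j)) ->
  forall i, L (w i).
Proof.
move=> subL; elim: k w => [|k IHk] w wL; first by case.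
have [r0 [rad0 L0]] := wL ord0.
have [t t1] := rad0 ord0 1; rewrite mul1r in t1.
pose q j := t * r0 (lift ord0 j).
have radq j : jacobson (q j) by apply: jacobsonMl.
have {}L0 : L (w ord0 - \sum_j q j *: w (lift ord0 j)).
  have := submoduleZ subL t L0; rewrite big_ord_recl opprD addrA.
  rewrite scalerBr -{1}[w ord0]scale1r -scalerBl scalerA t1 scale1r scaler_sumr.
  by congr (L (_ - _)); apply: eq_bigr => j _; rewrite scalerA.
have IH : forall i, L (w (lift ord0 i)).
  apply: IHk => i; have [r [radr Lr]] := wL (lift ord0 i).
  exists (fun j => r (lift ord0 j) + r ord0 * q j); split.
    by move=> j; apply: jacobsonD => //; apply: jacobsonMl.
  have := submoduleD subL Lr (submoduleZ subL (r ord0) L0).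
  rewrite big_ord_recl scalerBr opprD !addrA [X in L (X - _)]addrAC subrK.
  rewrite scaler_sumr -addrA -opprD -big_split /=.
  congr (L (_ - _)); apply: eq_bigr => j _.
  by rewrite scalerDl scalerA.
move=> i; case: (unliftP ord0 i) => [j ->//|->].
rewrite -[w _](subrK (\sum_j q j *: w (lift ord0 j))).
apply: submoduleD => //; apply: submodule_sum => // j _.
exact: submoduleZ.
Qed.

(** * Families of local generators *)

Section Families.
Variable M : lmodType S.

Definition lincomb k (m : 'I_k -> M) : set M :=
  [set x | exists a : 'I_k -> S, x = \sum_i a i *: m i].

Definition local_family k (e : 'I_k -> S) (m : 'I_k -> M) :=
  forall j, local_idempotent (e j) /\ e j *: m j = m j.

(** A relation in which the coefficient of m j generates S (e j) is exactly one
    that allows m j = e j *: m j to be eliminated. *)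
Definition irredundant k (e : 'I_k -> S) (m : 'I_k -> M) :=
  forall v : 'I_k -> S, \sum_j v j *: m j = 0 -> forall j c, c * v j <> e j.

Lemma irredundant_subfamily k (e : 'I_k -> S) (m : 'I_k -> M) :
  local_family e m ->
  exists n (f : 'I_n -> 'I_k), let e' := e \o f in let m' := m \o f in
    irredundant e' m' /\ lincomb m `<=` lincomb m'.
Proof.
elim: k e m => [|k IHk] e m lem.
  by exists 0, id; split=> [v _ []|].
have [irr|] := pselect (irredundant e m); first by exists k.+1, id; split.
move=> /existsNP[v /not_implyP[v0 /existsNP[j /existsNP[c /contrapT cv]]]].
have [|n [f [irr spm]]] := IHk (e \o lift j) (m \o lift j).
  by move=> i; exact: lem.
exists n, (lift j \o f); split => // x [a ->]; apply: spm.
have mj : m j = - \sum_i (c * v (lift j i)) *: m (lift j i).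
  apply/eqP; rewrite -addr_eq0 -(lem j).2 -cv -scalerA.
  under eq_bigr do rewrite -scalerA.
  rewrite -scaler_sumr -scalerDr.
  by move: v0; rewrite (bigD1_ord j) //= => ->; rewrite scaler0.
exists (fun i => a (lift j i) - a j * (c * v (lift j i))).
rewrite (bigD1_ord j) //= mj scalerN scaler_sumr addrC -sumrB.
by apply: eq_bigr => i _; rewrite scalerBl scalerA.
Qed.

End Families.
End Local.
(** * Modules of rows and projective covers *)

Section Rows.
Variables (S : pzRingType) (k : nat) (e : 'I_k -> S).
Local Notation V := {ffun 'I_k -> S^o}.

(** The row module below is the direct sum of the left ideals S (e j), and this
    is the generator of its i-th summand. *)
Definition basis_row (i : 'I_k) : V := [ffun j => if j == i then e i else 0].

Lemma row_decomp (v : V) : (forall j, v j * e j = v j) ->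
  v = \sum_j (v j : S) *: basis_row j.
Proof.
move=> ve; apply/ffunP => i; rewrite sum_ffunE (bigD1 i) //= big1 => [|j ji].
  by rewrite addr0 !ffunE eqxx -[RHS]/(v i * e i) ve.
by rewrite !ffunE eq_sym (negbTE ji) scaler0.
Qed.

Section Eval.
Variables (M : lmodType S) (m : 'I_k -> M).

Definition row_eval (v : V) : M := \sum_j (v j : S) *: m j.

Lemma row_eval_linear : linear row_eval.
Proof.
move=> a u v; rewrite /row_eval scaler_sumr -big_split /=.
by apply: eq_bigr => j _; rewrite !ffunE scalerDl scalerA.
Qed.

HB.instance Definition _ :=
  GRing.isLinear.Build S V M _ row_eval row_eval_linear.

Lemma row_eval_basis i : row_eval (basis_row i) = e i *: m i.
Proof.
rewrite /row_eval (bigD1 i) //= big1 => [|j ji].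
  by rewrite addr0 !ffunE eqxx.
by rewrite !ffunE (negbTE ji) scale0r.
Qed.

End Eval.

Definition row_pred : {pred V} := [pred v : V | [forall j, v j * e j == v j]].

Lemma row_predP (v : V) :
  reflect (forall j, v j * e j = v j) (v \in row_pred).
Proof. exact/'forall_eqP. Qed.

Fact row_submod : submod_closed row_pred.
Proof.
split=> [|a u v /row_predP ue /row_predP ve]; apply/row_predP => j.
  by rewrite !ffunE mul0r.
by rewrite !ffunE mulrDl -mulrA ue ve.
Qed.

HB.instance Definition _ := GRing.isSubmodClosed.Build S V row_pred row_submod.

Record row_module := RowModule { row_val : V; _ : row_val \in row_pred }.

HB.instance Definition _ := [isSub for row_val].
HB.instance Definition _ := [Choice of row_module by <:].
HB.instance Definition _ := [SubChoice_isSubLmodule of row_module by <:].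

Lemma basis_row_in i : e i * e i = e i -> basis_row i \in row_pred.
Proof.
move=> ei; apply/row_predP => j; rewrite ffunE.
by case: eqP => [->//|_]; rewrite mul0r.
Qed.

End Rows.

Section Covers.
Variables (S : pzRingType) (M : lmodType S).
Variables (k : nat) (e : 'I_k -> S) (m : 'I_k -> M).
Hypotheses (lem : local_family e m) (irr : irredundant e m).

Let idem j : e j * e j = e j. Proof. by case: (lem j) => -[]. Qed.

(** The vectors r play the role of elements of the kernel of the map from the
    direct sum of the S (e j) to M.  Irredundancy and locality force their
    coordinates into the radical, so that Nakayama's lemma applies. *)
Lemma irredundant_nakayama (W : lmodType S) (L : set W) (w : 'I_k -> W) :
  submodule L ->
  (forall i, exists r : 'I_k -> S, [/\ forall j, r j * e j = r j,
     \sum_j r j *: m j = 0 & L (w i - \sum_j r j *: w j)]) ->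
  forall i, L (w i).
Proof.
move=> subL wL; apply: nakayama => // i.
have [r [re r0 Lr]] := wL i; exists r; split=> // j.
exact: (jacobson_of_local (lem j).1 (re j) (@irr _ r0 j)).
Qed.

(** The homomorphism S f -> S x lifts through the projective cover formed by the
    rows, and the lift splits.  Concretely, the row a of coefficients of x over
    m is the image of f; it generates all rows by Nakayama's lemma, which gives
    c i with c i *: a the i-th basis row.  The products a_j c_j are the
    idempotents of the copies of S (e j) inside S f. *)
Lemma split_idempotent f (x : M) : f * f = f -> f *: x = x ->
  lincomb m x -> (forall j, exists s, m j = s *: x) ->
  exists E : 'I_k -> S,
    [/\ forall j, local_idempotent (E j), forall j, f * E j * f = E j,
        forall i j, i <> j -> E i * E j = 0 & \sum_j E j *: x = x].
Proof.
move=> ff fx [a0 xE] /choice[b0 mE].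
have [a [fa ae ax]] : exists a : {ffun 'I_k -> S^o},
    [/\ forall j, f * a j = a j, a \in row_pred e & row_eval m a = x].
  exists [ffun j => f * a0 j * e j]; split.
  - by move=> j; rewrite ffunE !mulrA ff.
  - apply/row_predP => j; rewrite !ffunE -[LHS]mulrA.
    by case: (lem j) => -[->].
  - rewrite -[RHS]fx [in RHS]xE scaler_sumr; apply: eq_bigr => j _.
    by rewrite ffunE -2!scalerA (lem j).2.
pose L := [set s *: a | s in [set: S]].
have subL : submodule L.
  split=> [|_ _ [s _ <-] [t _ <-]|c _ [s _ <-]].
  - by exists 0; rewrite ?scale0r.
  - by exists (s + t); rewrite ?scalerDl.
  - by exists (c * s); rewrite ?scalerA.
have /choice[b bE] : forall i, exists s, s *: a = basis_row e i.
  suff Lrow : forall i, L (basis_row e i).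
    by move=> i; have [s _ sE] := Lrow i; exists s.
  apply: irredundant_nakayama => // i.
  exists (basis_row e i - b0 i *: a); split.
  - by apply/row_predP; rewrite rpredB ?rpredZ ?basis_row_in.
  - rewrite -[LHS]/(row_eval m (basis_row e i - b0 i *: a)).
    rewrite linearB linearZ_LR /=.
    by rewrite row_eval_basis ax -mE (lem i).2 subrr.
  - rewrite -row_decomp.
      by rewrite opprB addrCA subrr addr0; exists (b0 i).
    by apply/row_predP; rewrite rpredB ?rpredZ ?basis_row_in.
pose c i := e i * b i * f.
have ca i j : c i * a j = if j == i then e i else 0.
  have := congr1 (fun u : {ffun 'I_k -> S^o} => u j) (bE i).
  rewrite !ffunE -!mulrA fa -[b i *: _]/(b i * a j) => ->.
  by case: eqP => _; rewrite ?mulr0.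
have cx i : c i *: x = m i.
  rewrite -scalerA fx -scalerA -ax -linearZ_LR bE /= row_eval_basis.
  by rewrite !(lem i).2.
have {}ae j : a j * e j = a j by move/row_predP: ae; apply.
exists (fun j => a j * c j); split.
- move=> j; apply: local_transfer (lem j).1 (ae j) _ _; last by rewrite ca eqxx.
  by rewrite /c !mulrA idem.
- by move=> j; rewrite mulrA fa -mulrA /c -[_ * f * f]mulrA ff.
- move=> i j /eqP; rewrite eq_sym => /negbTE ij.
  by rewrite mulrA -[_ * a j]mulrA ca ij mulr0 mul0r.
- by rewrite -[RHS]ax; apply: eq_bigr => j _; rewrite -scalerA cx.
Qed.

Definition row_gen (i : 'I_k) : row_module e :=
  RowModule (basis_row_in (idem i)).

Lemma row_gen_decomp (v : row_module e) :
  v = \sum_j (val v j : S) *: row_gen j.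
Proof.
apply: val_inj; rewrite linear_sum {1}(@row_decomp _ _ e (val v)).
  by apply: eq_bigr => j _; rewrite linearZ_LR.
exact/row_predP/(valP v).
Qed.

(** A homomorphism out of the row module is determined by the images y_j of the
    generators, and any images are possible once multiplied by e_j. *)
Lemma row_module_projective : projective_module (row_module e).
Proof.
move=> M' N g f gsurj.
have /choice[m' m'E] : forall j, exists y, g y = f (row_gen j).
  move=> j; have : [set: N] (f (row_gen j)) by [].
  by rewrite -gsurj => -[y _ yE]; exists y.
exists (row_eval m' \o val : {linear row_module e -> M'}) => v.
rewrite [in RHS](row_gen_decomp v) /= /row_eval !linear_sum.
by apply: eq_bigr => j _; rewrite !linearZ_LR m'E.
Qed.

(** If the kernel and L span everything, each generator agrees modulo L with an
    element of the kernel, so the preceding form of Nakayama's lemma puts it in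
    L. *)
Lemma irredundant_projective_cover :
  (forall x, lincomb m x) -> has_projective_cover M.
Proof.
move=> spanm.
pose p : {linear row_module e -> M} := row_eval m \o val.
have pgen j : p (row_gen j) = m j.
  by rewrite /p /= row_eval_basis; case: (lem j).
exists (row_module e), p; split; first exact: row_module_projective.
  apply/seteqP; split=> // x _; have [a ->] := spanm x.
  exists (\sum_j a j *: row_gen j); rewrite // linear_sum.
  by apply: eq_bigr => j _; rewrite linearZ_LR pgen.
move=> L subL KL; apply/seteqP; split=> // v _.
suff Lgen : forall i, L (row_gen i).
  rewrite (row_gen_decomp v); apply: submodule_sum => // j _.
  exact: submoduleZ.
apply: irredundant_nakayama => // i.
have : [set: row_module e] (row_gen i) by [].
rewrite -KL => -[u /= pu [l Ll ulE]].
exists (val u); split.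
- exact/row_predP/(valP u).
- exact: pu.
- by rewrite -row_gen_decomp -ulE addrC addKr.
Qed.

End Covers.
(** * Quotient modules *)

Section QuotientModule.
Local Open Scope quotient_scope.
Variables (S : pzRingType) (M : lmodType S) (N : set M).
Hypothesis subN : submodule N.

(** The proof that N is a submodule is an argument of the predicate, so that the
    closure properties can be attached to it as canonical instances. *)
Definition submod_pred of submodule N : {pred M} := fun x => `[< N x >].

Fact submod_pred_closed : submod_closed (submod_pred subN).
Proof.
split=> [|a x y /asboolP Nx /asboolP Ny]; apply/asboolP.
  exact: submodule0.
by apply: submoduleD => //; exact: submoduleZ.
Qed.

HB.instance Definition _ :=
  GRing.isSubmodClosed.Build S M (submod_pred subN) submod_pred_closed.

Definition quotient_module := Quotient.quot (submod_pred subN).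

HB.instance Definition _ := GRing.Zmodule.on quotient_module.

Definition quot_proj (x : M) : quotient_module := \pi_(quotient_module) x.

Lemma quot_projD x y : quot_proj (x + y) = quot_proj x + quot_proj y.
Proof. exact: (raddfD \pi_(quotient_module)). Qed.

Lemma quot_projE x y : quot_proj x = quot_proj y <-> N (x - y).
Proof.
split=> [/eqP|Nxy].
  by rewrite -Quotient.idealrBE => /asboolP.
by apply/eqP; rewrite -Quotient.idealrBE; apply/asboolP.
Qed.

Lemma quot_projK (x : quotient_module) : quot_proj (repr x) = x.
Proof. exact: reprK. Qed.

Definition quot_scale (a : S) (x : quotient_module) := quot_proj (a *: repr x).

Lemma quot_scaleE a x : quot_scale a (quot_proj x) = quot_proj (a *: x).
Proof.
apply/quot_projE; rewrite -scalerBr; apply: submoduleZ => //.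
exact/quot_projE/quot_projK.
Qed.

Fact quot_scaleA a b x : quot_scale a (quot_scale b x) = quot_scale (a * b) x.
Proof. by rewrite -[x]quot_projK !quot_scaleE scalerA. Qed.
Fact quot_scale1 : left_id 1 quot_scale.
Proof. by move=> x; rewrite -[x]quot_projK !quot_scaleE scale1r. Qed.
Fact quot_scaleDr : right_distributive quot_scale +%R.
Proof.
move=> a x y; rewrite -[x]quot_projK -[y]quot_projK -quot_projD.
by rewrite !quot_scaleE scalerDr quot_projD.
Qed.
Fact quot_scaleDl x : {morph quot_scale^~ x : a b / a + b}.
Proof.
by move=> a b; rewrite -[x]quot_projK !quot_scaleE scalerDl quot_projD.
Qed.

HB.instance Definition _ := GRing.Zmodule_isLmodule.Build S quotient_module
  quot_scaleA quot_scale1 quot_scaleDr quot_scaleDl.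

Lemma quot_projZ a x : quot_proj (a *: x) = a *: quot_proj x.
Proof. by rewrite -quot_scaleE. Qed.

Lemma quot_proj_eq0 x : quot_proj x = 0 <-> N x.
Proof.
have <- : quot_proj 0 = 0 by exact: (raddf0 \pi_(quotient_module)).
by have := quot_projE x 0; rewrite subr0.
Qed.

End QuotientModule.
(** * Simple modules and their projective covers *)

Section Simple.
Variable S : pzRingType.

Lemma maximal_submodule (M : lmodType S) (L : set M) (x : M) :
  submodule L -> ~ L x ->
  exists N : set M, [/\ submodule N, L `<=` N, ~ N x
    & forall N' : set M, submodule N' -> N `<=` N' -> ~ N' x -> N' `<=` N].
Proof.
move=> subL Lx.
pose admissible (X : set M) := [/\ submodule X, L `<=` X & ~ X x].
(* The empty set is let in as an upper bound for the empty chain. *)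
have [F FP Ftot|N [NP Nmax]] :=
  @Zorn_bigcup M [set X | X = set0 \/ admissible X].
- have [[X FX [y Xy]]|F0] := pselect (exists2 X, F X & X !=set0); last first.
    left; apply/seteqP; split=> // y [X FX Xy]; apply: F0.
    by exists X => //; exists y.
  have adm Y z : F Y -> Y z -> admissible Y.
    by move=> /FP[->|].
  have [subX LX _] := adm _ _ FX Xy.
  right; split; last by move=> [Y FY Yx]; have [_ _] := adm _ _ FY Yx; apply.
    split=> [|u v [Y FY Yu] [Z FZ Zv]|a u [Y FY Yu]].
    + by exists X => //; exact: submodule0.
    + have [subY _ _] := adm _ _ FY Yu; have [subZ _ _] := adm _ _ FZ Zv.
      have [YZ|ZY] := Ftot _ _ FY FZ.
        by exists Z => //; apply: submoduleD => //; exact: YZ.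
      by exists Y => //; apply: submoduleD => //; exact: ZY.
    + have [subY _ _] := adm _ _ FY Yu.
      by exists Y => //; apply: submoduleZ.
  by move=> u Lu; exists X => //; exact: LX.
have [subN LN Nx] : admissible N.
  case: NP => // N0; have : admissible L by split.
  move=> admL; case: (Nmax L); last by right.
  by rewrite N0; split=> [|L0] //; apply: (L0 0); exact: submodule0.
exists N; split=> // N' subN' NN' N'x; apply: contrapT => nN'N.
apply: (Nmax N'); first by split.
by right; split=> // u /LN /NN'.
Qed.

Lemma quotient_simple (M : lmodType S) (N : set M) (subN : submodule N) x :
  (forall y, exists a, y = a *: x) -> ~ N x ->
  (forall N' : set M, submodule N' -> N `<=` N' -> ~ N' x -> N' `<=` N) ->
  simple_module (quotient_module subN).
Proof.
move=> xgen Nx Nmax; split=> [|K subK].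
  by exists (quot_proj subN x) => /quot_proj_eq0.
pose N' := quot_proj subN @^-1` K.
have subN' : submodule N'.
  split=> [|u v Ku Kv|a u Ku]; rewrite /N' /=.
  - rewrite (quot_proj_eq0 subN 0).2; [exact: submodule0|exact: submodule0].
  - by rewrite quot_projD; apply: submoduleD.
  - by rewrite quot_projZ; apply: submoduleZ.
have [N'x|N'x] := pselect (N' x); [right|left]; apply/seteqP; split=> //.
- move=> y _; rewrite -[y]quot_projK; have [a ->] := xgen (repr y).
  exact: (submoduleZ subN').
- move=> y Ky; rewrite /= -[y]quot_projK; apply/quot_proj_eq0.
  apply: (Nmax N') => //; last by rewrite /N' /= quot_projK.
  move=> u Nu; rewrite /N' /= (quot_proj_eq0 subN u).2 //; exact: submodule0.
- by move=> y ->; exact: submodule0.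
Qed.

Definition scale_at (P : lmodType S) (y : P) (s : S^o) : P := (s : S) *: y.

Lemma scale_at_linear (P : lmodType S) (y : P) : linear (scale_at y).
Proof. by move=> a s t; rewrite /scale_at scalerDl scalerA. Qed.

HB.instance Definition _ (P : lmodType S) (y : P) :=
  GRing.isLinear.Build S S^o P _ (scale_at y) (scale_at_linear y).

Lemma cyclic_submodule (P : lmodType S) (y : P) :
  submodule (range (scale_at y)).
Proof.
split=> [|_ _ [s _ <-] [t _ <-]|a _ [s _ <-]].
- by exists 0 => //; rewrite linear0.
- by exists (s + t) => //; rewrite linearD.
- by exists (a *: s) => //; rewrite linearZ_LR.
Qed.

Lemma simple_cyclic (M : lmodType S) (x y : M) :
  simple_module M -> x <> 0 -> exists a, y = a *: x.
Proof.
move=> [_ smpl] x0; have [E|E] := smpl _ (cyclic_submodule x).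
  have : range (scale_at x) x by exists 1 => //; rewrite /scale_at scale1r.
  by rewrite E.
have : [set: M] y by [].
by rewrite -E => -[a _ <-]; exists a.
Qed.

(** Let y lie above x in the cover P.  As M is simple and the kernel is
    superfluous, an element of P outside the kernel generates P, in particular y
    does.  A section h of S -> P, s |-> s y, exists by projectivity and turns y
    into an idempotent e with P isomorphic to S e.  For s in e S e, the elements s x and
    (e - s) x have sum x <> 0, so one of them is nonzero, and the corresponding
    element of P generates y: this is a left inverse of s or e - s. *)
Lemma simple_cover_idempotent (M : lmodType S) (x : M) :
  simple_module M -> has_projective_cover M -> x <> 0 ->
  exists2 e, local_idempotent e & e *: x = x.
Proof.
move=> smplM [P [p [projP psurj psup]]] x0.
have psurj' z : exists u, p u = z.
  by have : [set: M] z by []; rewrite -psurj => -[u _ <-]; exists u.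
have gen z : p z <> 0 -> forall u, exists a, u = a *: z.
  move=> pz0 u; suff E : range (scale_at z) = setT.
    by have : [set: P] u by []; rewrite -E => -[a _ <-]; exists a.
  apply: psup; first exact: cyclic_submodule.
  apply/seteqP; split=> // v _.
  have [a aE] := simple_cyclic (p v) smplM pz0.
  exists (v - a *: z); first by rewrite /= linearB linearZ_LR -aE subrr.
  by exists (a *: z); [exists a|rewrite subrK].
have [y py] := psurj' x.
have [h hE] : exists h : {linear P -> S^o}, forall u, scale_at y (h u) = u.
  apply: (projP _ _ (scale_at y : {linear S^o -> P}) idfun).
  apply/seteqP; split=> // u _.
  by have [|a ->] := gen y _ u; [rewrite py|exists a].
have hy u : (h u : S) *: y = u := hE u.
have hZ a u : h (a *: u) = a * h u by rewrite linearZ_LR.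
pose e : S := h y.
have ee : e * e = e by rewrite -hZ hy.
have ex : e *: x = x by rewrite -py -linearZ_LR /e hy.
have inv s : e * s * e = s -> s *: x <> 0 -> exists c, c * s = e.
  move=> sE sx0.
  have [|c cE] := gen (s *: y) _ y; first by rewrite linearZ_LR py.
  exists c; rewrite /e cE !hZ -/e; congr (_ * _).
  by rewrite -sE -!mulrA ee.
exists e => //; split=> // [e0|s sE].
  by apply: x0; rewrite -ex e0 scale0r.
have [sx0|sx0] := pselect (s *: x = 0); last first.
  by have [c] := inv s sE sx0; exists c; left.
have [||c cE] := inv (e - s); last by exists c; right.
  by rewrite mulrBr mulrBl ee ee sE.
by rewrite scalerBl sx0 ex subr0.
Qed.

End Simple.
(** * Corner rings *)

Section CornerRings.

(** The hypothesis leaves 0 and 1 as the only idempotents.  If x y = 1, then y x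
    is an idempotent, and it is not 0; so right inverses are two-sided.  If
    (x + y) u = 1, apply the hypothesis to x u, for which 1 - x u = y u. *)
Lemma local_ring_of_right_inverses (C : pzRingType) : (1 : C) <> 0 ->
  (forall x : C, exists c, x * c = 1 \/ (1 - x) * c = 1) -> local_ring C.
Proof.
move=> C1 Cl.
have idem1 (g : C) : g * g = g -> g = 0 \/ g = 1.
  move=> gg; have [c [gc|gc]] := Cl g.
    by right; rewrite -[LHS]mulr1 -gc mulrA gg.
  by left; rewrite -[LHS]mulr1 -gc mulrA mulrBr mulr1 gg subrr mul0r.
have rinv x y : x * y = 1 :> C -> invertible x.
  move=> xy; exists y; split=> //.
  have [||//] := idem1 (y * x).
    by rewrite mulrA -[y * x * y]mulrA xy mulr1.
  have : x * (y * x) * y = 1 by rewrite mulrA xy mul1r.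
  by move=> + yx; rewrite yx mulr0 mul0r => /esym.
split=> //; split=> [[y [y0 _]]|x y nx ny|x nx].
- by apply: C1; rewrite -y0 mul0r.
- move=> [u [xyu _]]; have [c [xc|yc]] := Cl (x * u).
    by apply/nx/(rinv _ (u * c)); rewrite mulrA.
  have xu : 1 - x * u = y * u by rewrite -xyu mulrDl addrAC subrr add0r.
  by apply/ny/(rinv _ (u * c)); rewrite mulrA -xu.
- move=> [y [xy _]]; apply/nx/(rinv _ (- y)).
  by rewrite mulrN -mulNr.
Qed.

Variable A : pzRingType.

(** Multiplication in A^c is reversed, so that left inverses in A^c become right
    inverses in the corner ring of A. *)
Lemma local_idempotent_corner (e : A) (ee : e * e = e) :
  local_ring (corner ee) <-> local_idempotent (e : A^c).
Proof.
split=> [[C1 [_ addC _]]|[_ e0 le]].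
  have inv1 : invertible (1 : corner ee) by exists 1; rewrite mulr1.
  split=> // [e0|s sE]; first by apply: C1; apply: val_inj.
  have sE' : e * (s : A) * e == s.
    by apply/eqP; rewrite -mulrA; exact: sE.
  pose x := Corner ee sE'.
  have [xinv|xninv] := pselect (invertible x).
    have [y [xy _]] := xinv; exists (val y); left.
    exact: (congr1 val xy).
  have [[y [xy _]]|xninv'] := pselect (invertible (1 - x)).
    by exists (val y); right; exact: (congr1 val xy).
  by case: (addC _ _ xninv xninv'); rewrite addrCA subrr addr0.
apply: local_ring_of_right_inverses => [C1|x].
  by apply: e0; exact: (congr1 val C1).
have [|c cE] := le (val x).
  exact: etrans (mulrA _ _ _) (cornerE x).
have cP : e * (e * c * e : A) * e == e * c * e.
  by rewrite !mulrA ee -[_ * e * e]mulrA ee.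
exists (Corner ee cP).
have cE' (s : corner ee) :
    c * (val s : A^c) = (e : A^c) -> s * Corner ee cP = 1.
  move=> sc; apply: val_inj => /=; rewrite !mulrA corner_mulr.
  have sc' : val s * (c : A) = e := sc.
  by rewrite sc' ee.
by case: cE => cE; [left; apply: cE'|right; apply: cE'].
Qed.

End CornerRings.
(** * Open ideals and discrete modules *)

Section TopologicalRing.
Variable R : topologicalPzRingType.
Local Notation S := R^c.

Lemma right_ideal_submodule (I : set R) :
  right_ideal I <-> submodule (I : set S^o).
Proof.
by split=> [[I0 ID IM]|[I0 ID IM]]; split=> // x y; [apply: IM|apply: IM].
Qed.

Lemma open_preimage_mull (a : R) (U : set R) :
  open U -> open [set r | U (a * r)].
Proof.
move=> oU; apply: (@open_comp _ _ (fun r => a * r)) => // r _.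
apply: (@continuous_comp _ _ _ (fun r => (a, r)) (fun x : R * R => x.1 * x.2)).
  by apply: cvg_pair; [exact: cvg_cst|exact: cvg_id].
exact: mul_continuous.
Qed.

Lemma continuous_subl (a : R) : continuous (fun r : R => a - r).
Proof.
move=> r.
apply: (@continuous_comp _ _ _ (fun r => (a, r)) (fun x : R * R => x.1 - x.2)).
  by apply: cvg_pair; [exact: cvg_cst|exact: cvg_id].
exact: sub_continuous.
Qed.

Lemma nbhs_translate (a : R) (U : set R) :
  open U -> U 0 -> nbhs a [set r | U (a - r)].
Proof.
move=> oU U0; apply: open_nbhs_nbhs; split; last by rewrite /= subrr.
apply: (@open_comp _ _ (fun r => a - r)) => // r _; exact: continuous_subl.
Qed.

Lemma open_submodule_sup (I N : set S^o) : submodule N ->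
  open (I : set R) -> I 0 -> I `<=` N -> open (N : set R).
Proof.
move=> subN oI I0 IN; rewrite openE => r Nr.
have := nbhs_translate r oI I0; apply: filterS => s /= Irs.
have -> : s = r - (r - s) :> R by rewrite opprB addrCA subrr addr0.
exact: (submoduleB subN Nr (IN _ Irs)).
Qed.

Lemma quotient_discrete (N : set S^o) (subN : submodule N) :
  open (N : set R) -> discrete_module (quotient_module subN).
Proof.
move=> oN m.
have scalE (r : S) : r *: m = quot_proj subN (r *: repr m).
  by rewrite quot_projZ quot_projK.
have annE : annihilator m = [set r | N ((repr m : R) * r)].
  apply/seteqP; split=> r; rewrite /annihilator /= scalE.
    by move=> /quot_proj_eq0.
  by move=> ?; apply/quot_proj_eq0.
rewrite annE; split; first exact: open_preimage_mull.
apply/right_ideal_submodule; rewrite -annE.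
split=> [|x y|a x]; rewrite /annihilator /=.
- by rewrite scale0r.
- by move=> x0 y0; rewrite scalerDl x0 y0 addr0.
- by move=> x0; rewrite -[_ *: m]scalerA x0 scaler0.
Qed.

Lemma simple_finitely_generated (M : rmodType R) :
  simple_module M -> finitely_generated M.
Proof.
move=> smpl; have [[x x0] _] := smpl; exists 1, (fun=> x) => y.
by have [a ->] := simple_cyclic y smpl x0; exists (fun=> a); rewrite big_ord1.
Qed.

(** The annihilator of a generator g is open, so it contains 1 minus a finite
    partial sum of the idempotents; hence g is the finite sum of the e_z g,
    which are local generators. *)
Lemma semiperfect_covers : topologically_semiperfect R ->
  forall M : rmodType R, discrete_module M -> finitely_generated M ->
    has_projective_cover M.
Proof.
move=> [Z [e [ee [_ _ sum1 loc]]]] M discM [n [g gen]].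
have /choice[A gA] : forall i, exists A : {fset Z},
    g i = \sum_(z : A) (e (val z) : S) *: g i.
  move=> i; have [oA [A0 _ _]] := discM (g i).
  have [A _ AP] := sum1 _ (nbhs_translate 1 oA A0).
  exists A; have := AP A (fsubset_refl A).
  rewrite /annihilator /= scalerBl scale1r => /subr0_eq {1}->.
  by rewrite /summability.partial_sum scaler_suml.
pose T := {i : 'I_n & A i}.
pose et (t : T) : S := e (val (tagged t)).
pose mt (t : T) : M := et t *: g (tag t).
have loct : local_family (fun j : 'I_#|{: T}| => et (enum_val j))
    (fun j => mt (enum_val j)).
  move=> j; split; first exact: (local_idempotent_corner (ee _)).1 (loc _).
  by rewrite /mt scalerA; congr (_ *: _); exact: ee.
have [k [f [irr spanf]]] := irredundant_subfamily loct.
apply: (irredundant_projective_cover _ irr); first by move=> j; apply: loct.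
move=> x; apply: spanf; have [a ->] := gen x.
exists (fun j => a (tag (enum_val j))).
rewrite -(big_enum_val (fun t => a (tag t) *: mt t)) /=.
under eq_bigr do rewrite gA scaler_sumr.
by rewrite (sig_big_dep _ _
  (fun i (z : A i) => a i *: ((e (val z) : S) *: g i))).
Qed.

(** * From covers of simple modules to idempotents *)

Section FromCovers.
Hypothesis simple_covers : forall M : rmodType R,
  discrete_module M -> simple_module M -> has_projective_cover M.

(** Otherwise a maximal left ideal N contains I and all local idempotents.  It
    is open, so S / N has a projective cover, and this gives a local idempotent
    e congruent to 1 modulo N, which is absurd as e lies in N. *)
Lemma local_idempotents_dense (I : set S^o) :
  submodule I -> open (I : set R) ->
  exists l : seq (S * S), (forall p, p \in l -> local_idempotent p.2) /\
    I (1 - \sum_(p <- l) p.1 * p.2).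
Proof.
move=> subI oI.
pose L : set S^o := [set x | exists l : seq (S * S),
  (forall p, p \in l -> local_idempotent p.2) /\
  I (x - \sum_(p <- l) p.1 * p.2)].
have subL : submodule L.
  split=> [|x y [l [locl Ix]] [h [loch Iy]]|a x [l [locl Ix]]].
  - by exists [::]; split=> //; rewrite big_nil subr0; exact: (submodule0 subI).
  - exists (l ++ h); split.
      by move=> p; rewrite mem_cat => /orP[]; [exact: locl|exact: loch].
    by rewrite big_cat /= opprD addrACA; exact: (submoduleD subI Ix Iy).
  - exists [seq (a * p.1, p.2) | p <- l]; split.
      by move=> _ /mapP[p pl ->]; exact: (locl p).
    rewrite big_map; under eq_bigr do rewrite /= -mulrA.
    by rewrite -mulr_sumr -mulrBr; exact: (submoduleZ subI a Ix).
have IL : I `<=` L by move=> x Ix; exists [::]; rewrite big_nil subr0.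
have eL (e : S) : local_idempotent e -> L e.
  move=> loce; exists [:: (1, e)]; split; first by move=> p /[!inE] /eqP ->.
  by rewrite big_seq1 mul1r subrr; exact: (submodule0 subI).
change (L 1).
apply: contrapT => nL1.
have [N [subN LN N1 Nmax]] := maximal_submodule subL nL1.
have gen1 (y : S^o) : exists a : S, y = a *: (1 : S^o).
  by exists y; rewrite -[RHS]/(y * 1 : S) mulr1.
have oN : open (N : set R).
  apply: (open_submodule_sup subN oI); first exact: (submodule0 subI).
  exact: subset_trans LN.
have smpl := quotient_simple subN gen1 N1 Nmax.
have x0 : quot_proj subN 1 <> 0 by move/quot_proj_eq0.
have [e loce] := simple_cover_idempotent smpl
  (simple_covers (@quotient_discrete _ subN oN) smpl) x0.
rewrite -quot_projZ => /quot_projE Ne1; apply: N1.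
have {}Ne1 : N (e - 1) by rewrite -{1}[e]mulr1; exact: Ne1.
rewrite -[1](subKr e); apply: (submoduleB subN) => //; exact/LN/eL.
Qed.

(** The elements s with s f in J form an open left ideal.  Writing 1 modulo it
    as a combination of local idempotents e_i shows that the elements e_i x,
    where x is the class of f modulo J, generate S x. *)
Lemma idempotent_splitting (f : S) (J : set S^o) : f * f = f ->
  submodule J -> open (J : set R) ->
  exists (k : nat) (E : 'I_k -> S),
    [/\ forall j, local_idempotent (E j), forall j, f * E j * f = E j,
        forall i j, i <> j -> E i * E j = 0 & J (f - \sum_j E j)].
Proof.
move=> ff subJ oJ.
pose I : set S^o := [set s | J ((s : S) * f)].
have subI : submodule I.
  split=> [|s t Is It|a s Is]; rewrite /I /=.
  - by rewrite mul0r; exact: (submodule0 subJ).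
  - by rewrite mulrDl; exact: (submoduleD subJ Is It).
  - by rewrite -[a *: s]/(a * s : S) -mulrA; exact: (submoduleZ subJ a Is).
have oI : open (I : set R) by exact: (open_preimage_mull (f : R) oJ).
have [l [locl Il]] := local_idempotents_dense subI oI.
pose x := quot_proj subJ f.
have fx : f *: x = x by rewrite -quot_projZ; congr quot_proj.
pose e (i : 'I_(size l)) := (tnth (in_tuple l) i).2.
have loce : local_family e (fun i => (e i : S) *: x).
  have loci i : local_idempotent (e i) by apply/locl/mem_tnth.
  by move=> i; split=> //; rewrite scalerA; case: (loci i) => ->.
have [k [h [irr spanh]]] := irredundant_subfamily loce.
have loch : local_family (e \o h) (fun i => e (h i) *: x).
  by move=> i; apply: loce.
have xspan : lincomb (fun i => e (h i) *: x) x.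
  apply: spanh; exists (fun i => (tnth (in_tuple l) i).1).
  under eq_bigr do rewrite scalerA.
  rewrite -scaler_suml.
  have <- : \sum_(p <- l) p.1 * p.2 =
      \sum_i (tnth (in_tuple l) i).1 * e i by rewrite big_tnth.
  apply/eqP; rewrite -subr_eq0 -{1}[x]scale1r -scalerBl; apply/eqP.
  by rewrite -quot_projZ; apply/quot_proj_eq0.
have xgen i : exists s, e (h i) *: x = s *: x by exists (e (h i)).
have [E [locE fE orthE Ex]] := split_idempotent loch irr ff fx xspan xgen.
exists k, E; split=> //; apply/(quot_projE subJ).
rewrite -/x -[LHS]Ex -scaler_suml -quot_projZ; congr quot_proj.
rewrite -[LHS]/((\sum_j E j) * f) mulr_suml; apply: eq_bigr => j _.
by rewrite -fE -mulrA ff.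
Qed.

End FromCovers.

(** * The idempotents of a topologically semiperfect ring *)

Lemma countable_ideal_base : right_linear R -> countable_base_at0 R ->
  exists I : nat -> open_right_ideal R,
    forall U : set R, nbhs 0 U -> exists n, I n `<=` U.
Proof.
move=> rlin [B [/countable_injP[c cinj] Bopen Bbase]].
have /choice[I IP] : forall n, exists I : open_right_ideal R,
    forall V, B V -> c V = n -> I `<=` V.
  move=> n; have [[V [BV cV]]|nV] := pselect (exists V, B V /\ c V = n).
    have [I IV] := rlin V (open_nbhs_nbhs (Bopen V BV)).
    exists I => W BW cW; have -> // : W = V.
    by apply: cinj; rewrite ?inE // cV.
  have [I _] := rlin setT filterT; exists I => V BV cV.
  by case: nV; exists V.
exists I => U /Bbase[V BV VU]; exists (c V).
exact: subset_trans (IP _ _ BV erefl) VU.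
Qed.

(** Split the rest of 1 repeatedly, at stage n until what remains lies in I_n.
    The idempotents are indexed by their stage and their position in it. *)
Lemma covers_semiperfect : right_linear R -> countable_base_at0 R ->
  (forall M : rmodType R, discrete_module M -> simple_module M ->
     has_projective_cover M) ->
  topologically_semiperfect R.
Proof.
move=> rlin cbase covers.
have [I0 Ibase] := countable_ideal_base rlin cbase.
pose I n : set S^o := ideal_set (I0 n).
have subI n : submodule (I n).
  exact/right_ideal_submodule/ideal_right.
have /choice[d dP] : forall nf : nat * S, exists d : {k : nat & 'I_k -> S},
    nf.2 * nf.2 = nf.2 -> let E := projT2 d in
    [/\ forall j, local_idempotent (E j), forall j, nf.2 * E j * nf.2 = E j,
        forall i j, i <> j -> E i * E j = 0
      & I nf.1 (nf.2 - \sum_j E j)].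
  move=> [n f]; have [ff|nff] := pselect (f * f = f); last first.
    by exists (existT _ 0 (fun=> 0)).
  have [k [E EP]] :=
    idempotent_splitting covers ff (subI n) (@ideal_open _ (I0 n)).
  by exists (existT _ k E).
(* rest n is what remains of 1 before stage n. *)
pose rest := fix rest n : S :=
  if n is n'.+1 then rest n' - \sum_j projT2 (d (n', rest n')) j else 1.
pose E n := projT2 (d (n, rest n)).
have restS n : rest n.+1 = rest n - \sum_j E n j by [].
have idem n : rest n * rest n = rest n.
  elim: n => [|n IHn]; first exact: mulr1.
  have [locE fEf orthE _] := dP (n, rest n) IHn.
  rewrite restS; case: (orthogonal_complement IHn _ fEf orthE) => // j.
  by case: (locE j).
have EP n := dP (n, rest n) (idem n).
have EE n j : E n j * E n j = E n j by case: (EP n) => /(_ j)[].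
have fEf n j : rest n * E n j * rest n = E n j.
  by case: (EP n) => _ /(_ j).
have orthE n i j : i <> j -> E n i * E n j = 0.
  by move=> ij; case: (EP n) => _ _ /(_ i j ij).
have fE n j : rest n * E n j = E n j by rewrite -fEf !mulrA idem.
have Ef n j : E n j * rest n = E n j by rewrite -fEf -!mulrA idem.
have restP n := orthogonal_complement (idem n) (EE n) (fEf n) (@orthE n).
have restM n m : (n <= m)%N ->
    rest n * rest m = rest m /\ rest m * rest n = rest m.
  elim: m => [|m IHm]; first by rewrite leqn0 => /eqP ->; rewrite idem.
  rewrite leq_eqVlt => /orP[/eqP ->|/IHm[nm mn]]; first by rewrite idem.
  have [_ fg gf _] := restP m; rewrite -restS in fg gf.
  by split; [rewrite -{1}fg mulrA nm fg|rewrite -{1}gf -mulrA mn gf].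
have Erest n m i : (n < m)%N -> E n i * rest m = 0 /\ rest m * E n i = 0.
  move=> nm; have [nm1 nm2] := restM _ _ nm.
  have [_ _ _ /(_ i)[Eg gE]] := restP n; rewrite -restS in Eg gE.
  by rewrite -{1}nm1 -nm2 mulrA Eg mul0r -mulrA gE mulr0.
have rest_ideal n s : I n ((s : S) * rest n.+1).
  by apply: (submoduleZ (subI n)); case: (EP n).
pose Z := {n : nat & 'I_(projT1 (d (n, rest n)))}.
pose e (z : Z) : S := E (tag z) (tagged z).
have e_ideal n z : (n < tag z)%N -> I n (e z).
  move=> nz; rewrite /e -Ef -(restM _ _ nz).2 mulrA; exact: rest_ideal.
have orth (z w : Z) : z <> w -> e z * e w = 0.
  case: z w => [n i] [m j] zw; rewrite /e /=.
  have [nm|mn|nm] := ltngtP n m.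
  - by rewrite -[E m j]fE mulrA (Erest _ _ _ nm).1 mul0r.
  - by rewrite -[E n i]Ef -mulrA (Erest _ _ _ mn).2 mulr0.
  - by case: m / nm j zw => j zw; apply: orthE => ij; rewrite ij in zw.
have early_fin n : finite_set [set z : Z | (tag z <= n)%N].
  have -> : [set z : Z | (tag z <= n)%N] =
      \bigcup_(m in `I_n.+1)
        range (existT (fun n => 'I_(projT1 (d (n, rest n)))) m).
    apply/seteqP; split=> [[m i] /= mn|z [m mn [i _ <-]]]; last exact: mn.
    by exists m => //; exists i.
  apply: bigcup_finite => [|m _]; first exact: finite_II.
  exact: finite_image finite_finset.
have ee (z : Z) : (e z : R) * e z = e z by exact: EE.
exists Z, e, ee; split.
- move=> J; have [n nJ] : exists n, I n `<=` (J : set R).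
    apply: Ibase; apply: open_nbhs_nbhs; split; first exact: ideal_open.
    by case: (ideal_right J).
  apply: sub_finite_set (early_fin n) => z /= Jz.
  by rewrite leqNgt; apply/negP => nz; apply/Jz/nJ/e_ideal.
- by move=> z w zw; apply: (orth w z) => wz; apply: zw.
- move=> U U1.
  have U1' : nbhs (0 : R) [set r | U (1 - r)].
    by apply: continuous_subl; rewrite subr0.
  have [n nU] := Ibase _ U1'.
  exists (fset_set [set z : Z | (tag z <= n)%N]) => // A /= /fsubsetP subA.
  pose t : S := 1 - summability.partial_sum e A.
  suff It : I n t.
    by have := nU _ It; rewrite /= /t opprB addrCA subrr addr0.
  have te z : z \in A -> t * e z = 0.
    move=> zA; rewrite mulrBl mul1r mulr_suml (bigD1 [` zA]%fset) //=.
    rewrite big1 ?addr0 => [|w wz]; first by rewrite [e z * _]ee subrr.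
    by apply: orth => wzE; case/eqP: wz; apply: val_inj.
  (* The idempotents split off up to stage n all belong to A, so t kills them
     and hence their sum, which is 1 - rest n.+1. *)
  suff <- : t * rest n.+1 = t by exact: rest_ideal.
  suff : forall m, (m <= n.+1)%N -> t * rest m = t by apply.
  elim=> [_|m IHm mn]; first exact: mulr1.
  rewrite restS mulrBr IHm 1?ltnW // mulr_sumr big1 ?subr0 // => j _.
  apply: (te (existT _ m j)); apply: subA.
  by rewrite in_fset_set //= inE /= -ltnS.
- move=> z; apply/local_idempotent_corner.
  by case: (EP (tag z)) => + _ _ _; apply.
Qed.

End TopologicalRing.

Theorem theorem8p11 (R : topologicalPzRingType)
    (R_complete : complete_separated_right_linear R)
    (R_countable : countable_base_at0 R) :
  [<-> topologically_semiperfect R;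
       forall M : rmodType R, discrete_module M -> simple_module M ->
         has_projective_cover M;
       forall M : rmodType R, discrete_module M -> finitely_generated M ->
         has_projective_cover M].
Proof.
have [rlin _] := R_complete.
have H31 := @semiperfect_covers R.
have H12 := covers_semiperfect rlin R_countable.
tfae=> [H M dM /simple_finitely_generated|/H12|H]; [exact: H31|exact: H31|].
by apply: H12 => M dM /simple_finitely_generated; exact: H.
Qed.
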